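(* Let $f_1,\dots,f_m:\mathbb{R}^n\to\mathbb{R}$ be convex and continuously differentiable, each $\nabla f_i$ being $L_i$-Lipschitz continuous for a given $L_i\ge 0$. Let $g:\mathbb{R}^m\to\mathbb{R}\cup\{+\infty\}$ be convex, proper, lower semicontinuous, $L_g$-Lipschitz continuous on its domain (i.e. $|g(u)-g(v)|\le L_g\|u-v\|$ for all $u,v\in\mathrm{dom}\,g$), and nondecreasing in its $i$-th argument for every $i$ with $L_i>0$. Put $F=(f_1,\dots,f_m)$, $\bm{L}=(L_1,\dots,L_m)^T$ and $H(x,y)=F(x)+\nabla F(x)(y-x)+\frac{\bm{L}}{2}\|y-x\|^2$. Assume that $g\circ F$ is proper and has a minimizer, that for every $x\in F^{-1}(\mathrm{dom}\,g)$ the function $y\mapsto g(H(x,y))$ has a minimizer, and that there is a point $\bar x\in F^{-1}(\mathrm{int}\,\mathrm{dom}\,g)$. Then for any $x\in F^{-1}(\mathrm{dom}\,g)$, $y\in p(x)$ and $\nu\in\mathcal{V}(x,y)$: (i) if $H(x,y)\in\mathrm{int}\,\mathrm{dom}\,g$, then $\bm{L}^T\nu\le L_g\|\bm{L}\|$; (ii) if $H(x,y)\in\mathrm{bd}\,\mathrm{dom}\,g$, then $$\bm{L}^T\nu\le 8L_g\left(\|\nabla F(x)\|_{\rm op}+(3\|x-y\|+\|\bar x-x\|)\frac{\|\bm{L}\|}{2}\right)^2\frac{\mathrm{dist}[F(\bar x),\mathrm{bd}\,\mathrm{dom}\,g]+\|\bm{L}\|\,\|\bar x-x\|^2/2}{\mathrm{dist}[F(\bar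 x),\mathrm{bd}\,\mathrm{dom}\,g]^2}.$$
   Context: $\|\cdot\|$ is the Euclidean norm, $\|\cdot\|_{\rm op}$ the operator norm; $\mathrm{dom}\,g=\{z:g(z)<+\infty\}$; $\mathrm{int}$, $\mathrm{bd}$ denote interior and boundary; $\partial g$ is the convex subdifferential; $\nabla F(x)$ is the $m\times n$ Jacobian of $F$. For $x\in F^{-1}(\mathrm{dom}\,g)$, $p(x)=\mathrm{argmin}_{y\in\mathbb{R}^n}g(H(x,y))$, and for $y\in p(x)$, $\mathcal{V}(x,y)=\{\nu\in\partial g(H(x,y)):\nabla_yH(x,y)^T\nu=0\}$, where $\nabla_yH(x,y)=\nabla F(x)+\bm{L}(y-x)^T$. *)

(* Defs.v *)
From HB Require Import structures.
From mathcomp Require Import all_boot all_order all_algebra.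
From mathcomp Require Import all_classical all_reals all_analysis.
Import Order.TTheory GRing.Theory Num.Theory.
Import numFieldNormedType.Exports.

Set Implicit Arguments.
Unset Strict Implicit.
Unset Printing Implicit Defensive.

Local Open Scope classical_set_scope.
Local Open Scope ring_scope.

(* Vectors of R^k are row vectors. The library norm on matrices is the sup norm:
   it provides the topology (interior, closure, differentiability), while every
   metric quantity uses the Euclidean norm [enorm]. *)

Definition dot {R : realType} {k : nat} (u v : 'rV[R]_k) : R :=
  \sum_(i < k) u 0 i * v 0 i.

Definition enorm {R : realType} {k : nat} (u : 'rV[R]_k) : R :=
  Num.sqrt (dot u u).

(* The row vector v *m A^T is the transpose of the column vector A v^T. *)
Definition opnorm {R : realType} {m n : nat} (A : 'M[R]_(m, n)) : R :=
  sup [set enorm (v *m A^T) | v in [set v : 'rV[R]_n | enorm v <= 1]].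

Definition boundary {T : topologicalType} (A : set T) : set T :=
  closure A `\` A°.

(* This is 0, the default value of [inf], when A is empty. *)
Definition enorm_dist {R : realType} {k : nat} (z : 'rV[R]_k)
    (A : set 'rV[R]_k) : R :=
  inf [set enorm (z - w) | w in A].

Definition grad {R : realType} {n : nat} (f : 'rV[R]_n -> R) (x : 'rV[R]_n) :
    'rV[R]_n :=
  \row_(j < n) 'D_(delta_mx 0 j) f x.

Definition edom {R : realType} {T : Type} (h : T -> \bar R) : set T :=
  [set z | (h z < +oo)%E].

Definition eproper {R : realType} {T : Type} (h : T -> \bar R) : Prop :=
  edom h !=set0 /\ forall z, h z != -oo%E.

Definition argmin {R : realType} {T : Type} (h : T -> \bar R) : set T :=
  [set y | forall z, (h y <= h z)%E].

(* Meant for functions that do not take the value -oo. *)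
Definition econvex {R : realType} {m : nat} (g : 'rV[R]_m -> \bar R) : Prop :=
  forall (u v : 'rV[R]_m) (t : R), 0 < t < 1 ->
    (g (t *: u + (1 - t) *: v)%R <= t%:E * g u + (1 - t)%:E * g v)%E.

Definition lipschitz_on_dom {R : realType} {m : nat} (k : R)
    (g : 'rV[R]_m -> \bar R) : Prop :=
  forall u v, edom g u -> edom g v -> (`|g u - g v| <= (k * enorm (u - v))%:E)%E.

Definition nondecreasing_arg {R : realType} {m : nat}
    (g : 'rV[R]_m -> \bar R) (i : 'I_m) : Prop :=
  forall u v : 'rV[R]_m, (forall j, j != i -> u 0 j = v 0 j) ->
    u 0 i <= v 0 i -> (g u <= g v)%E.

Definition subdiff {R : realType} {m : nat} (g : 'rV[R]_m -> \bar R)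
    (u : 'rV[R]_m) : set 'rV[R]_m :=
  [set nu | forall z, (g u + (dot nu (z - u))%:E <= g z)%E].

Definition vecF {R : realType} {m n : nat} (f : 'I_m -> 'rV[R]_n -> R)
    (x : 'rV[R]_n) : 'rV[R]_m :=
  \row_(i < m) f i x.

(* The library Jacobian 'J acts on row vectors by right multiplication; the
   usual m x n Jacobian matrix is its transpose. *)
Definition jacF {R : realType} {m n : nat} (f : 'I_m -> 'rV[R]_n -> R)
    (x : 'rV[R]_n) : 'M[R]_(m, n) :=
  ('J (vecF f) x)^T.

Definition modelH {R : realType} {m n : nat} (f : 'I_m -> 'rV[R]_n -> R)
    (L : 'rV[R]_m) (x y : 'rV[R]_n) : 'rV[R]_m :=
  vecF f x + (y - x) *m (jacF f x)^T + (enorm (y - x) ^+ 2) *: (2^-1 *: L).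

Definition gradyH {R : realType} {m n : nat} (f : 'I_m -> 'rV[R]_n -> R)
    (L : 'rV[R]_m) (x y : 'rV[R]_n) : 'M[R]_(m, n) :=
  jacF f x + L^T *m (y - x).

Definition argminH {R : realType} {m n : nat} (f : 'I_m -> 'rV[R]_n -> R)
    (L : 'rV[R]_m) (g : 'rV[R]_m -> \bar R) (x : 'rV[R]_n) : set 'rV[R]_n :=
  argmin (fun y => g (modelH f L x y)).

(* nu *m A = 0 is the transpose of the equation A^T nu^T = 0. *)
Definition multipliers {R : realType} {m n : nat} (f : 'I_m -> 'rV[R]_n -> R)
    (L : 'rV[R]_m) (g : 'rV[R]_m -> \bar R) (x y : 'rV[R]_n) : set 'rV[R]_m :=
  [set nu | subdiff g (modelH f L x y) nu /\ nu *m gradyH f L x y = 0].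

(* Main.v *)
(** Write [lambda = L^T nu] and [w = x + t (xbar - x)].  Stationarity of [y] for the
    quadratic [nu^T H(x, .)] gives [nu^T (H(x,w) - H(x,y)) = (lambda/2) |w - y|^2],
    so the subgradient inequality bounds [lambda |w - y| / 2] by [Lg K], where
    [|H(x,w) - H(x,y)| <= K |w - y|].  It remains to bound [|w - y|] below: since
    [H(x,y)] is a boundary point of [dom g], it is enough that [dom g] contains a
    ball of radius [r] about [H(x,w)], which gives [r <= K |w - y|].  Put
    [d = dist(F(xbar), bd dom g)] and [D = |L| |xbar - x|^2 / 2].  Componentwise,
    [H(x,w) <= (1-t) F(x) + t F(xbar) + t^2 |xbar - x|^2 L / 2], with equality where
    [L_i = 0] ([f_i] is affine there); by convexity and monotonicity [r = t d - t^2 D]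
    is admissible, and [t = d / (2 (d + D))] gives [r >= d^2 / (4 (d + D))]. *)

Require Import Defs.
From HB Require Import structures.
From mathcomp Require Import all_boot all_order all_algebra.
From mathcomp Require Import all_classical all_reals all_analysis.
From mathcomp Require Import ring lra.
Import Order.TTheory GRing.Theory Num.Theory.
Import numFieldNormedType.Exports.

Local Open Scope classical_set_scope.
Local Open Scope ring_scope.

(** * Euclidean geometry: Cauchy-Schwarz, comparison with the sup norm, operator norm, distance to a
    boundary *)

Section Euclidean.
Context {R : realType}.
Implicit Types k m n : nat.

Lemma dotC k (u v : 'rV[R]_k) : dot u v = dot v u.
Proof. by apply: eq_bigr => i _; rewrite mulrC. Qed.

Lemma dotDl k (u v w : 'rV[R]_k) : dot (u + v) w = dot u w + dot v w.
Proof. by rewrite -big_split; apply: eq_bigr => i _; rewrite mxE mulrDl. Qed.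

Lemma dotDr k (u v w : 'rV[R]_k) : dot w (u + v) = dot w u + dot w v.
Proof. by rewrite !(dotC _ w) dotDl. Qed.

Lemma dotZl k a (u v : 'rV[R]_k) : dot (a *: u) v = a * dot u v.
Proof. by rewrite mulr_sumr; apply: eq_bigr => i _; rewrite mxE mulrA. Qed.

Lemma dotZr k a (u v : 'rV[R]_k) : dot u (a *: v) = a * dot u v.
Proof. by rewrite !(dotC _ u) dotZl. Qed.

Lemma dotNl k (u v : 'rV[R]_k) : dot (- u) v = - dot u v.
Proof. by rewrite -scaleN1r dotZl mulN1r. Qed.

Lemma dot_mulmx m n (u : 'rV[R]_m) (A : 'M[R]_(m, n)) (v : 'rV[R]_n) :
  dot (u *m A) v = dot u (v *m A^T).
Proof.
have dotE k (a b : 'rV[R]_k) : dot a b = (a *m b^T) 0 0.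
  by rewrite mxE; apply: eq_bigr => i _; rewrite mxE.
by rewrite !dotE trmx_mul trmxK mulmxA.
Qed.

Lemma dot_ge0 k (u : 'rV[R]_k) : 0 <= dot u u.
Proof. by apply: sumr_ge0 => i _; rewrite -expr2 sqr_ge0. Qed.

Lemma enorm_ge0 k (u : 'rV[R]_k) : 0 <= enorm u.
Proof. exact: sqrtr_ge0. Qed.

Lemma sqr_enorm k (u : 'rV[R]_k) : enorm u ^+ 2 = dot u u.
Proof. by rewrite sqr_sqrtr ?dot_ge0. Qed.

Lemma enormZ k a (u : 'rV[R]_k) : enorm (a *: u) = `|a| * enorm u.
Proof.
by rewrite /enorm dotZl dotZr mulrA -expr2 sqrtrM ?sqr_ge0// sqrtr_sqr.
Qed.

Lemma enormN k (u : 'rV[R]_k) : enorm (- u) = enorm u.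
Proof. by rewrite -scaleN1r enormZ normrN1 mul1r. Qed.

Lemma enorm_distC k (u v : 'rV[R]_k) : enorm (u - v) = enorm (v - u).
Proof. by rewrite -enormN opprB. Qed.

Lemma coord_le_enorm k (u : 'rV[R]_k) i : `|u 0 i| <= enorm u.
Proof.
rewrite -(ler_pXn2r (n := 2)) ?nnegrE ?enorm_ge0// sqr_enorm real_normK ?num_real//.
by rewrite /dot (bigD1 i)//= -expr2 lerDl sumr_ge0// => j _; rewrite -expr2 sqr_ge0.
Qed.

Lemma enorm_eq0 k (u : 'rV[R]_k) : enorm u = 0 -> u = 0.
Proof.
move=> u0; apply/rowP => i; rewrite mxE; apply/eqP.
by rewrite -normr_le0 -u0 coord_le_enorm.
Qed.

Lemma enorm0 k : enorm (0 : 'rV[R]_k) = 0.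
Proof. by rewrite -(scale0r 0) enormZ normr0 mul0r. Qed.

(** Cauchy-Schwarz: expand the squared norm of [enorm v *: u - enorm u *: v], then cancel
    [enorm u * enorm v], which is positive once zero vectors are set apart. *)
Lemma dot_le_enorm k (u v : 'rV[R]_k) : dot u v <= enorm u * enorm v.
Proof.
have [/enorm_eq0->|u0] := eqVneq (enorm u) 0.
  by rewrite -(scale0r 0) dotZl mul0r mulr_ge0 ?enorm_ge0.
have [/enorm_eq0->|v0] := eqVneq (enorm v) 0.
  by rewrite -(scale0r 0) dotZr mul0r mulr_ge0 ?enorm_ge0.
have ugt : 0 < enorm u by rewrite lt0r u0 enorm_ge0.
have vgt : 0 < enorm v by rewrite lt0r v0 enorm_ge0.
have := dot_ge0 _ (enorm v *: u - enorm u *: v).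
rewrite dotDl !dotDr -scaleNr !(dotZl, dotZr) -!sqr_enorm (dotC _ v u) => h.
rewrite -(ler_pM2l (mulr_gt0 ugt vgt)); nra.
Qed.

Lemma ler_enormD k (u v : 'rV[R]_k) : enorm (u + v) <= enorm u + enorm v.
Proof.
rewrite -(ler_pXn2r (n := 2)) ?nnegrE ?addr_ge0 ?enorm_ge0//.
rewrite sqr_enorm dotDl !dotDr sqrrD !sqr_enorm (dotC _ v u).
have := dot_le_enorm _ u v; lra.
Qed.

Lemma ler_dist_enorm k (u v : 'rV[R]_k) : `|enorm u - enorm v| <= enorm (u - v).
Proof.
have := ler_enormD _ (u - v) v; have := ler_enormD _ (v - u) u.
rewrite !subrK (enorm_distC _ v) => h1 h2.
by rewrite ler_norml; apply/andP; split; lra.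
Qed.

Lemma mx_norm_le_enorm k (u : 'rV[R]_k) : `|u| <= enorm u.
Proof.
rewrite [leLHS]mx_normrE bigmax_le ?enorm_ge0// => -[i j] _ /=.
by rewrite ord1 coord_le_enorm.
Qed.

(** The crude factor [k.+1] suffices for comparing topologies and, unlike [k], can be divided by in
    dimension 0. *)
Lemma enorm_le_mx_norm k (u : 'rV[R]_k) : enorm u <= k.+1%:R * `|u|.
Proof.
rewrite -(ler_pXn2r (n := 2)) ?nnegrE ?mulr_ge0 ?enorm_ge0// sqr_enorm.
have coord_le i : `|u 0 i| <= `|u|.
  rewrite [leRHS]mx_normrE; exact: (le_bigmax _ (fun ij => `|u ij.1 ij.2|) (0, i)).
apply: (@le_trans _ _ (\sum_(i < k) `|u| ^+ 2)).
  apply: ler_sum => i _; rewrite -expr2 -[leLHS]real_normK ?num_real//.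
  by rewrite ler_pXn2r ?nnegrE.
rewrite sumr_const card_ord -[leLHS]mulr_natl exprMn ler_wpM2r ?sqr_ge0//.
by rewrite -natrX ler_nat (leq_trans (leqnSn k))// expnS expn1 leq_pmulr.
Qed.

Lemma interiorP_enorm k (A : set 'rV[R]_k) u :
  A° u <-> exists2 e, 0 < e & forall v, enorm (v - u) < e -> A v.
Proof.
split=> [/nbhs_ballP[e e0 eA]|[e e0 eA]].
  exists e => // v vu; apply: eA; rewrite mx_norm_ball /ball_ /= distrC.
  exact: le_lt_trans (mx_norm_le_enorm _ _) vu.
apply/nbhs_ballP; exists (e / k.+1%:R) => /=; first by rewrite divr_gt0.
move=> v; rewrite mx_norm_ball /ball_ /= => uv; apply: eA.
rewrite enorm_distC (le_lt_trans (enorm_le_mx_norm _ _))//.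
by rewrite mulrC -ltr_pdivlMr.
Qed.

(** Cauchy-Schwarz on each row. The constant is the Frobenius norm; it bounds the set in [opnorm],
    so that its [sup] is a genuine supremum and not a default value. *)
Lemma enorm_mul_trmx_le m n (A : 'M[R]_(m, n)) (v : 'rV[R]_n) :
  enorm (v *m A^T) <= Num.sqrt (\sum_i dot (row i A) (row i A)) * enorm v.
Proof.
have S0 : 0 <= \sum_i dot (row i A) (row i A).
  by apply: sumr_ge0 => i _; exact: dot_ge0.
rewrite -(ler_pXn2r (n := 2)) ?nnegrE ?mulr_ge0 ?enorm_ge0 ?sqrtr_ge0//.
rewrite sqr_enorm exprMn sqr_sqrtr// mulr_suml; apply: ler_sum => i _.
have -> : (v *m A^T) 0 i = dot v (row i A).
  by rewrite mxE; apply: eq_bigr => j _; rewrite !mxE.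
rewrite -expr2 -[leLHS]real_normK ?num_real// -sqr_enorm -exprMn.
rewrite ler_pXn2r ?nnegrE ?mulr_ge0 ?enorm_ge0// mulrC ler_norml dot_le_enorm andbT.
by rewrite lerNl -dotNl -(enormN _ v) dot_le_enorm.
Qed.

Lemma enorm_mul_opnorm m n (A : 'M[R]_(m, n)) (v : 'rV[R]_n) :
  enorm (v *m A^T) <= opnorm A * enorm v.
Proof.
have [v0|v0] := eqVneq (enorm v) 0.
  by rewrite v0 (enorm_eq0 _ _ v0) mul0mx enorm0 mulr0.
have vgt : 0 < enorm v by rewrite lt0r v0 enorm_ge0.
rewrite -ler_pdivrMr// mulrC -[(enorm v)^-1]gtr0_norm ?invr_gt0// -enormZ scalemxAl.
apply: ub_le_sup; last first.
  by exists ((enorm v)^-1 *: v) => //=; rewrite enormZ gtr0_norm ?invr_gt0// mulVf.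
exists (Num.sqrt (\sum_i dot (row i A) (row i A))) => _ [w /= w1 <-].
rewrite (le_trans (enorm_mul_trmx_le _ _ _ _))// ler_piMr//; exact: sqrtr_ge0.
Qed.

Lemma enorm_dist_le k (z w : 'rV[R]_k) (A : set 'rV[R]_k) :
  A w -> enorm_dist z A <= enorm (z - w).
Proof.
by move=> Aw; apply: ge_inf; [exists 0 => _ [v _ <-]; exact: enorm_ge0|exists w].
Qed.

(** Some ball around [z] lies in the open set [A°] and so misses the boundary. The boundary must be
    nonempty because [inf] of the empty set is 0. *)
Lemma enorm_dist_boundary_gt0 k (A : set 'rV[R]_k) z :
  boundary A !=set0 -> A° z -> 0 < enorm_dist z (boundary A).
Proof.
move=> [w bw] Az.
have /interiorP_enorm[e e0 eA] : (A°)° z.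
  by move: Az; have := @open_interior _ A; rewrite openE; apply.
apply: (lt_le_trans e0).
apply: lb_le_inf; first by exists (enorm (z - w)), w.
move=> _ [v [_ nAv] <-]; rewrite leNgt; apply/negP => zv.
by apply: nAv; apply: eA; rewrite enorm_distC.
Qed.

(** Connectedness of the segment from [z] to [w]: it is too short to reach the boundary, so its
    trace on [A°] is both open and closed in it. *)
Lemma enorm_ball_sub k (A : set 'rV[R]_k) z :
  A° z -> forall w, enorm (w - z) < enorm_dist z (boundary A) -> A° w.
Proof.
move=> Az w wz.
pose p (s : R) := z + s *: (w - z).
have pc : continuous p.
  by move=> s; apply: cvgD; [exact: cvg_cst|apply: cvgZr_tmp; exact: cvg_id].
have conn : connected (p @` `[0, 1]).
  apply: connected_continuous_connected; first exact: segment_connected.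
  exact: continuous_subspaceT.
suff : p @` `[0, 1] `&` A° = p @` `[0, 1].
  move=> E; have : (p @` `[0, 1]) w.
    by exists 1; rewrite /= ?in_itv/= ?ler01 ?lexx// /p scale1r addrC subrK.
  by rewrite -E => -[].
apply: conn.
- exists z; split => //; exists 0; rewrite /= ?in_itv/= ?ler01 ?lexx//.
  by rewrite /p scale0r addr0.
- by exists A° => //; exact: open_interior.
(* On the segment [A°] and [closure A] coincide: a point in the second only would be a boundary
   point at distance at most [enorm (w - z)] from [z]. *)
- exists (closure A); first exact: closed_closure.
  apply/seteqP; split=> v [pv Av]; split => //.
    exact: (subset_closure (interior_subset Av)).
  apply: contrapT => nAv; move: wz; apply/negP; rewrite -leNgt.
  have bv : boundary A v by [].
  apply: le_trans (enorm_dist_le _ z _ _ bv) _.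
  case: pv => s /= /[!in_itv]/= /andP[s0 s1] <-.
  by rewrite /p opprD addNKr enormN enormZ ger0_norm// ler_piMl// enorm_ge0.
Qed.

End Euclidean.

(** * Differentiable convex functions: tangent inequality, gradients, Jacobian coordinates *)

Section ConvexFunctions.
Context {R : realType}.
Implicit Types m n : nat.

Lemma convex_function_setTP n (h : 'rV[R]_n -> R) : convex_function setT h ->
  forall x z (s : R), 0 <= s <= 1 ->
    h (x + s *: (z - x)) <= (1 - s) * h x + s * h z.
Proof.
move=> hconv x z s /andP[s0 s1].
have := hconv (Itv01 s0 s1) z x (mem_set I) (mem_set I).
rewrite convRE /= /unstable.onem addrC; apply: le_trans.
rewrite le_eqVlt; apply/orP; left.
apply/eqP; congr h; rewrite /conv /= /unstable.onem.
by rewrite scalerBl scale1r scalerBr addrCA addrA.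
Qed.

(** Convexity bounds the difference quotients with step in []0, 1]] by [h z - h x]; the derivative
    is their limit from the right. *)
Lemma convex_tangent_le n (h : 'rV[R]_n -> R) x z :
  convex_function setT h -> differentiable h x ->
  h x + 'D_(z - x) h x <= h z.
Proof.
move=> /convex_function_setTP hconv dh; rewrite addrC -lerBrDr.
have quot_cvg := @diff_derivable _ _ _ h x (z - x) dh.
rewrite /derive (cvg_at_rightE _ _ quot_cvg); apply: limr_le.
  by apply/cvg_ex; case/cvg_ex: quot_cvg => l /cvg_dnbhs_at_right; exists l.
near=> s.
have s0 : 0 < s by [].
have s1 : s <= 1 by near: s; exact: nbhs_right_le.
have := hconv x z s; rewrite (ltW s0) s1 => /(_ isT) hs.
rewrite /= -[leLHS]/(s^-1 * _) mulrC ler_pdivrMr// (addrC _ x); lra.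
Unshelve. all: by end_near. Qed.

Lemma derive_grad n (h : 'rV[R]_n -> R) x v :
  differentiable h x -> 'D_v h x = dot (grad h x) v.
Proof.
move=> dh; rewrite deriveE// [v in LHS]row_sum_delta linear_sum.
by apply: eq_bigr => i _; rewrite linearZ /= mxE deriveE// mulrC.
Qed.

(** The tangent inequalities at [x] and at [z] are opposite bounds when the two gradients agree. *)
Lemma constant_grad_affine n (h : 'rV[R]_n -> R) x z :
  convex_function setT h -> (forall y, differentiable h y) ->
  grad h x = grad h z -> h z = h x + 'D_(z - x) h x.
Proof.
move=> hconv dh gradE; apply/le_anti/andP; split; last exact: convex_tangent_le.
have := convex_tangent_le _ _ z x hconv (dh z).
by rewrite !derive_grad// gradE -[x - z]opprB dotC dotNl dotC lerBlDr.
Qed.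

Lemma differentiable_vecF m n (f : 'I_m -> 'rV[R]_n -> R) x :
  (forall i, differentiable (f i) x) -> differentiable (vecF f) x.
Proof.
move=> df.
have -> : vecF f = \sum_(i < m) (fun y => f i y *: delta_mx 0 i).
  apply/funext => y; rewrite fct_sumE [LHS]row_sum_delta.
  by apply: eq_bigr => i _; rewrite mxE.
apply: differentiable_sum => i; exact: differentiableZl.
Qed.

Lemma mul_jacF_coord m n (f : 'I_m -> 'rV[R]_n -> R) x v i :
  (forall i, differentiable (f i) x) ->
  (v *m (jacF f x)^T) 0 i = 'D_v (f i) x.
Proof.
move=> df; have dF := differentiable_vecF _ _ f x df.
rewrite trmxK -deriveEjacobian// derive_mx ?mxE; last exact: diff_derivable.
by congr ('D_v _ x); apply/funext => y; rewrite mxE.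
Qed.
End ConvexFunctions.

(** * Extended-valued functions: domain, subgradients, monotonicity *)

Section ExtendedConvex.
Context {R : realType} {m : nat}.
Variable g : 'rV[R]_m -> \bar R.
Hypothesis g_proper : eproper g.

Lemma edom_fin_num u : edom g u -> g u \is a fin_num.
Proof. by move=> gu; rewrite fin_numElt ltNye gu g_proper.2. Qed.

Lemma edom_conv u v (t : R) : econvex g -> edom g u -> edom g v -> 0 < t < 1 ->
  edom g (t *: u + (1 - t) *: v).
Proof.
move=> gconv gu gv t01; apply: le_lt_trans (gconv u v t t01) _.
by rewrite -(fineK (edom_fin_num _ gu)) -(fineK (edom_fin_num _ gv)) ltry.
Qed.

Lemma subdiff_edom u nu : subdiff g u nu -> edom g u.
Proof.
move=> gnu; have [v gv] := g_proper.1.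
rewrite /edom /= ltey; apply/eqP => guoo; have := gnu v.
rewrite guoo addye// leye_eq => /eqP gvoo.
by move: gv; rewrite /edom /= gvoo ltxx.
Qed.

Lemma subdiff_lipschitz_le k u v nu : lipschitz_on_dom k g -> subdiff g u nu ->
  edom g v -> dot nu (v - u) <= k * enorm (v - u).
Proof.
move=> glip gnu gv; have gu := subdiff_edom _ _ gnu.
have := gnu v; have := glip v u gv gu.
rewrite -(fineK (edom_fin_num _ gu)) -(fineK (edom_fin_num _ gv)).
rewrite -EFinB abse_EFin -EFinD !lee_fin => /ler_normlW; lra.
Qed.

(** [lipschitz_on_dom] does not fix the sign of its constant; two distinct points of the domain
    do. *)
Lemma lipschitz_on_dom_ge0 k u v : lipschitz_on_dom k g -> edom g u -> edom g v ->
  0 < enorm (u - v) -> 0 <= k.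
Proof.
move=> glip gu gv uv; rewrite -(pmulr_lge0 _ uv) -lee_fin.
exact: le_trans (abse_ge0 _) (glip u v gu gv).
Qed.

Lemma nondecreasing_arg_le (L u v : 'rV[R]_m) :
  (forall i, 0 < L 0 i -> nondecreasing_arg g i) ->
  (forall i, u 0 i <= v 0 i) -> (forall i, ~~ (0 < L 0 i) -> u 0 i = v 0 i) ->
  (g u <= g v)%E.
Proof.
move=> gmono uv uvE.
(* Pass from [u] to [v] one coordinate at a time: [w k] has already changed the first [k] of
   them. *)
pose w k : 'rV[R]_m := \row_i (if (i < k)%N then v 0 i else u 0 i).
have w0 : u = w 0%N by apply/rowP => i; rewrite mxE ltn0.
have wm : v = w m by apply/rowP => i; rewrite mxE ltn_ord.
suff step k : (k <= m)%N -> (g u <= g (w k))%E by rewrite wm step.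
elim: k => [_|k IH km]; first by rewrite w0.
apply: le_trans (IH (ltnW km)) _.
have [Lk|Lk] := boolP (0 < L 0 (Ordinal km)).
  apply: (gmono _ Lk) => [j jk|]; last by rewrite !mxE /= ltnn ltnSn uv.
  rewrite !mxE ltnS [(j <= k)%N]leq_eqVlt (_ : (j == k :> nat) = false)//.
  exact: negbTE.
suff -> : w k = w k.+1 by [].
apply/rowP => i; rewrite !mxE ltnS [(i <= k)%N]leq_eqVlt.
case: (eqVneq (i : nat) k) => //= ik; rewrite ik ltnn.
by rewrite (_ : i = Ordinal km) ?uvE//; exact: val_inj.
Qed.

End ExtendedConvex.

(** * The quadratic model [modelH]: increments and values along a segment *)

Section Model.
Context {R : realType} {m n : nat}.
Variables (f : 'I_m -> 'rV[R]_n -> R) (L : 'rV[R]_m).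
Implicit Types x y w : 'rV[R]_n.

Lemma modelH_sub x y w : modelH f L x w - modelH f L x y =
  (w - y) *m (jacF f x)^T + (enorm (w - x) ^+ 2 - enorm (y - x) ^+ 2) *: (2^-1 *: L).
Proof.
have -> : w - y = (w - x) - (y - x) by rewrite opprB addrA subrK.
rewrite mulmxBl scalerBl /modelH.
by apply/rowP => i; rewrite !mxE; ring.
Qed.

Lemma sqr_enorm_dist_sub x y w : enorm (w - x) ^+ 2 - enorm (y - x) ^+ 2 =
  enorm (w - y) ^+ 2 + 2 * dot (y - x) (w - y).
Proof.
have -> : w - x = (w - y) + (y - x) by rewrite addrA subrK.
move: (w - y) (y - x) => a b.
by rewrite !sqr_enorm dotDl !dotDr (dotC _ a b); ring.
Qed.

Lemma dot_modelH_sub x y w nu : nu *m gradyH f L x y = 0 ->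
  dot nu (modelH f L x w - modelH f L x y) = dot L nu / 2 * enorm (w - y) ^+ 2.
Proof.
move=> stat.
have : dot (nu *m gradyH f L x y) (w - y) = 0.
  by rewrite stat -(scale0r 0) dotZl mul0r.
rewrite mulmxDr dotDl mulmxA.
have -> : nu *m L^T = (dot L nu)%:M.
  apply/matrixP => i j; rewrite !ord1 !mxE eqxx mulr1n.
  by apply: eq_bigr => k _; rewrite mxE mulrC.
rewrite mul_scalar_mx dotZl dot_mulmx => stat_w.
rewrite modelH_sub dotDr !dotZr sqr_enorm_dist_sub (dotC _ nu L).
(* Stationarity cancels the Jacobian term against the cross term of [sqr_enorm_dist_sub], leaving
   only the pure square. *)
by rewrite -[dot nu _](addrK (dot L nu * dot (y - x) (w - y))) stat_w; field.
Qed.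

Lemma enorm_modelH_sub x y w :
  enorm (modelH f L x w - modelH f L x y) <=
  (opnorm (jacF f x) + (enorm (w - x) + enorm (y - x)) * (enorm L / 2)) * enorm (w - y).
Proof.
rewrite modelH_sub (le_trans (ler_enormD _ _ _))// mulrDl.
apply: lerD; first exact: enorm_mul_opnorm.
rewrite !enormZ subr_sqr normrM (_ : `|2^-1| = 2^-1 :> R); last exact: gtr0_norm.
rewrite [X in _ * X * _ <= _]ger0_norm ?addr_ge0 ?enorm_ge0//.
rewrite -mulrA mulrC (mulrC 2^-1 (enorm L)).
rewrite ler_wpM2l ?mulr_ge0 ?addr_ge0 ?divr_ge0 ?enorm_ge0//.
rewrite (le_trans (ler_dist_enorm _ _ _))//.
by rewrite opprB addrA subrK.
Qed.

Hypothesis f_convex : forall i, convex_function setT (f i).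
Hypothesis f_diff : forall i x, differentiable (f i) x.
Hypothesis f_lip : forall i x y,
  enorm (grad (f i) x - grad (f i) y) <= L 0 i * enorm (x - y).

Lemma modelH_segment x z (t : R) i : modelH f L x (x + t *: (z - x)) 0 i =
  f i x + t * 'D_(z - x) (f i) x + t ^+ 2 * enorm (z - x) ^+ 2 * (2^-1 * L 0 i).
Proof.
rewrite /modelH (addrC x) addrK -scalemxAl enormZ exprMn real_normK ?num_real//.
rewrite 2!mxE [vecF f x 0 i]mxE [X in _ + X + _ = _]mxE mul_jacF_coord//.
by congr (_ + _); rewrite !mxE.
Qed.

Lemma modelH_segment_le x z (t : R) i : 0 <= t ->
  modelH f L x (x + t *: (z - x)) 0 i <=
  ((1 - t) *: vecF f x + t *: vecF f z
    + (t ^+ 2 * enorm (z - x) ^+ 2) *: (2^-1 *: L)) 0 i.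
Proof.
move=> t0; rewrite modelH_segment !mxE lerD2r.
have := convex_tangent_le _ _ _ z (f_convex i) (f_diff i x); nra.
Qed.

(** The Lipschitz bound makes the gradients of [f i] at [x] and [z] equal, so the tangent inequality
    is an equality. Equality is required here because [g] is monotone only in the arguments with
    [0 < L 0 i]. *)
Lemma modelH_segment_eq x z (t : R) i : L 0 i <= 0 ->
  modelH f L x (x + t *: (z - x)) 0 i =
  ((1 - t) *: vecF f x + t *: vecF f z
    + (t ^+ 2 * enorm (z - x) ^+ 2) *: (2^-1 *: L)) 0 i.
Proof.
move=> Li0; rewrite modelH_segment !mxE; congr (_ + _).
rewrite [f i z](constant_grad_affine _ _ x z (f_convex i) (f_diff i)); first by ring.
apply/eqP; rewrite -subr_eq0; apply/eqP/enorm_eq0/le_anti; rewrite enorm_ge0 andbT.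
by rewrite (le_trans (f_lip i x z))// mulr_le0_ge0// enorm_ge0.
Qed.

End Model.

(** The radius [t * (d / 2)] is a lower bound of [t * d - t ^+ 2 * D] under [t * D <= d / 2]. By
    monotonicity it is enough to place [c + (v - h)] in the domain, where [c] is the upper bound of
    the model on the segment. *)
Lemma edom_ball_modelH (R : realType) (m n : nat) (f : 'I_m -> 'rV[R]_n -> R)
    (L : 'rV[R]_m) (g : 'rV[R]_m -> \bar R) (x z : 'rV[R]_n) (d D t : R) :
  (forall i, convex_function setT (f i)) ->
  (forall i x, differentiable (f i) x) ->
  (forall i x y, enorm (grad (f i) x - grad (f i) y) <= L 0 i * enorm (x - y)) ->
  econvex g -> eproper g -> (forall i, 0 < L 0 i -> nondecreasing_arg g i) ->
  edom g (vecF f x) -> (forall v, enorm (v - vecF f z) < d -> edom g v) ->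
  enorm L * enorm (z - x) ^+ 2 / 2 = D -> 0 < t < 1 -> t * D <= d / 2 ->
  forall v, enorm (v - modelH f L x (x + t *: (z - x))) < t * (d / 2) -> edom g v.
Proof.
move=> fconv fdiff flip gconv gproper gmono gx ball_z defD /andP[t0 t1] tD v.
set h := modelH _ _ _ _ => vh.
pose b : 'rV[R]_m := (t ^+ 2 * enorm (z - x) ^+ 2) *: (2^-1 *: L).
pose c := (1 - t) *: vecF f x + t *: vecF f z + b.
have vE i : v 0 i = h 0 i + (v - h) 0 i by rewrite -{1}(subrK h v) mxE addrC.
suff gc : edom g (c + (v - h)).
  apply: le_lt_trans gc; apply: (nondecreasing_arg_le g L) => // i.
    by rewrite vE [leRHS]mxE lerD2r modelH_segment_le// ltW.
  by rewrite -leNgt vE [RHS]mxE => Li; congr (_ + _); exact: modelH_segment_eq.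
(* The whole perturbation is charged to the endpoint [vecF f z], at the cost of a factor [t^-1].
   Both [b] and [v - h] have norm at most [t * (d / 2)], the second strictly, so [u] stays in the
   ball of radius [d]. *)
pose u := vecF f z + t^-1 *: (b + (v - h)).
have -> : c + (v - h) = (1 - t) *: vecF f x + (1 - (1 - t)) *: u.
  rewrite (subKr 1 t) /u scalerDr scalerA divff ?gt_eqF// scale1r /c.
  by rewrite !addrA.
apply: edom_conv => //; last by rewrite subr_gt0 t1 gtrBl.
apply: ball_z; rewrite addrC addKr enormZ gtr0_norm ?invr_gt0// mulrC.
rewrite ltr_pdivrMr//.
apply: le_lt_trans (ler_enormD _ _ _) _.
have -> : enorm b = t * (t * D).
  rewrite /b scalerA enormZ ger0_norm; last first.
    by rewrite mulr_ge0 ?invr_ge0// mulr_ge0 ?sqr_ge0.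
  by rewrite -defD; field.
have : t * (t * D) <= t * (d / 2) by rewrite ler_pM2l.
lra.
Qed.

(** As [r > 0] forces [s > 0], one factor [s] cancels: [lam * s <= 2 * k * K]. For [lam > 0], [lam *
    r <= lam * (K * s) <= 2 * k * K ^+ 2]; otherwise the bound is trivial. *)
Lemma quadratic_multiplier_bound (R : realFieldType) (lam k r s K : R) :
  0 < r -> 0 <= s -> 0 <= k ->
  lam / 2 * s ^+ 2 <= k * (K * s) -> r <= K * s -> lam <= 2 * k * K ^+ 2 / r.
Proof.
move=> r0 s0 k0 lams rKs.
have {s0} sgt : 0 < s.
  rewrite lt0r s0 andbT; apply/eqP => s0E; move: rKs; rewrite s0E; lra.
have K0 : 0 <= K by rewrite -(pmulr_lge0 _ sgt) (le_trans _ rKs)// ltW.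
have {}lams : lam * s <= 2 * (k * K) by rewrite -(ler_pM2r sgt); nra.
rewrite ler_pdivlMr//.
have kK : 0 <= k * K by rewrite mulr_ge0.
have [lam0|lam0] := leP lam 0.
  by apply: (@le_trans _ _ 0); [rewrite mulr_le0_ge0// ltW|rewrite !mulr_ge0// sqr_ge0].
have : lam * r <= lam * (K * s) by rewrite ler_pM2l.
have : K * (lam * s) <= K * (2 * (k * K)) by rewrite ler_wpM2l.
nra.
Qed.

Theorem lemma4 (R : realType) (m n : nat) (f : 'I_m -> 'rV[R]_n -> R)
    (L : 'rV[R]_m) (g : 'rV[R]_m -> \bar R) (Lg : R) (xbar : 'rV[R]_n)
    (f_convex : forall i, convex_function setT (f i))
    (f_diff : forall i x, differentiable (f i) x)
    (f_C1 : forall i, continuous (grad (f i)))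
    (L_ge0 : forall i, 0 <= L 0 i)
    (f_lip : forall i x y,
       enorm (grad (f i) x - grad (f i) y) <= L 0 i * enorm (x - y))
    (g_convex : econvex g)
    (g_proper : eproper g)
    (g_lsc : lower_semicontinuous g)
    (g_lip : lipschitz_on_dom Lg g)
    (g_mono : forall i, 0 < L 0 i -> nondecreasing_arg g i)
    (gF_proper : eproper (g \o vecF f))
    (gF_min : argmin (g \o vecF f) !=set0)
    (gH_min : forall x, (vecF f @^-1` edom g) x -> argminH f L g x !=set0)
    (xbar_int : (vecF f @^-1` (edom g)°) xbar) :
  forall x y nu, (vecF f @^-1` edom g) x -> argminH f L g x y ->
    multipliers f L g x y nu ->
    ((edom g)° (modelH f L x y) -> dot L nu <= Lg * enorm L) /\
    (boundary (edom g) (modelH f L x y) ->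
       dot L nu <=
         8 * Lg
         * (opnorm (jacF f x)
            + (3 * enorm (x - y) + enorm (xbar - x)) * (enorm L / 2)) ^+ 2
         * ((enorm_dist (vecF f xbar) (boundary (edom g))
             + enorm L * enorm (xbar - x) ^+ 2 / 2)
            / enorm_dist (vecF f xbar) (boundary (edom g)) ^+ 2)).
Proof.
move=> x y nu gx _ [gnu stat]; have gH := subdiff_edom g g_proper _ _ gnu.
split=> [/interiorP_enorm[e e0 eg]|bdH].
  have [/enorm_eq0->|L0] := eqVneq (enorm L) 0.
    by rewrite enorm0 mulr0 -(scale0r 0) dotZl mul0r.
  have {L0} Lgt : 0 < enorm L by rewrite lt0r L0 enorm_ge0.
  (* Test the subgradient in the direction [L]: a step of length [e / 2] stays in the domain, and
     the factor [s] cancels from the resulting inequality. *)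
  pose s := e / 2 / enorm L.
  have s0 : 0 < s by rewrite !divr_gt0.
  have sL : s * enorm L = e / 2 by rewrite divfK// gt_eqF.
  have : edom g (modelH f L x y + s *: L).
    by apply: eg; rewrite addrC addKr enormZ gtr0_norm// sL; lra.
  move=> /(subdiff_lipschitz_le g g_proper _ _ _ _ g_lip gnu).
  rewrite [_ + s *: L]addrC addrK enormZ gtr0_norm// dotZr dotC.
  by rewrite mulrCA ler_pM2l.
have d0 := enorm_dist_boundary_gt0 _ _ _ (ex_intro _ _ bdH) xbar_int.
have ball_d := enorm_ball_sub _ _ _ xbar_int.
move: (enorm_dist _ _) d0 ball_d => d d0 ball_d.
set D := enorm L * _ / 2.
have D0 : 0 <= D by rewrite divr_ge0// mulr_ge0 ?enorm_ge0// sqr_ge0.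
pose t := d / (2 * (d + D)).
have dD : 0 < d + D by rewrite ltr_wpDr.
have t0 : 0 < t by rewrite divr_gt0// mulr_gt0.
(* This identity dictates the choice of [t]: it gives [t * D <= d / 2], as [edom_ball_modelH]
   demands. *)
have tdD : t * (d + D) = d / 2 by rewrite /t; field; rewrite gt_eqF.
have t1 : t < 1 by rewrite ltr_pdivrMr ?mulr_gt0//; lra.
have tD : t * D <= d / 2 by rewrite -tdD ler_pM2l// lerDr ltW.
pose w := x + t *: (xbar - x).
have t01 : 0 < t < 1 by rewrite t0.
have ball_w := edom_ball_modelH _ _ _ f L g x xbar d D t f_convex f_diff f_lip
  g_convex g_proper g_mono gx (fun v vd => interior_subset (ball_d v vd)) erefl t01 tD.
rewrite -/w in ball_w.
have r0 : 0 < t * (d / 2) by rewrite mulr_gt0// divr_gt0.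
have gw : edom g (modelH f L x w) by apply: ball_w; rewrite subrr enorm0.
(* Otherwise the ball around [modelH f L x w] would contain a smaller ball around [modelH f L x y],
   making this boundary point interior. *)
have rle : t * (d / 2) <= enorm (modelH f L x w - modelH f L x y).
  rewrite leNgt enorm_distC; apply/negP => rgt; case: bdH => _; apply.
  apply/interiorP_enorm; exists (t * (d / 2) - enorm (modelH f L x y - modelH f L x w)).
    by rewrite subr_gt0.
  move=> v vy; apply: ball_w; rewrite -(subrKA (modelH f L x y)).
  by rewrite (le_lt_trans (ler_enormD _ _ _))// -ltrBrDr.
have Lg0 := lipschitz_on_dom_ge0 _ _ _ _ g_lip gw gH (lt_le_trans r0 rle).
set K := opnorm _ + _.
(* Here [enorm (w - x)] is at most [enorm (xbar - x)] because [t < 1], and [enorm (y - x)] is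
   enlarged to [3 * enorm (x - y)] to match the stated constant. *)
have HK : enorm (modelH f L x w - modelH f L x y) <= K * enorm (w - y).
  apply: le_trans (enorm_modelH_sub _ _ _ _ _) _.
  rewrite ler_wpM2r ?enorm_ge0// lerD2l ler_wpM2r ?divr_ge0 ?enorm_ge0//.
  have -> : enorm (w - x) = t * enorm (xbar - x).
    by rewrite /w (addrC x) addrK enormZ gtr0_norm.
  rewrite addrC -(enorm_distC _ x y) lerD//.
    by rewrite ler_peMl ?enorm_ge0// ler1n.
  by rewrite ler_piMl ?enorm_ge0// ltW.
have := subdiff_lipschitz_le g g_proper _ _ _ _ g_lip gnu gw.
rewrite dot_modelH_sub// => lam_le.
have {}lam_le := le_trans lam_le (ler_wpM2l Lg0 HK).
have := quadratic_multiplier_bound _ _ _ _ _ _ r0 (enorm_ge0 _ _) Lg0 lam_le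
  (le_trans rle HK).
(* The radius equals [d ^+ 2 / (4 * (d + D))], whence the constant 8. *)
suff -> : 2 * Lg * K ^+ 2 / (t * (d / 2)) = 8 * Lg * K ^+ 2 * ((d + D) / d ^+ 2) by [].
by rewrite /t; field; rewrite !gt_eqF.
Qed.
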